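(* For every $\varepsilon>0$ there exists $\Delta_0$ such that the following holds for all $\Delta\geq\Delta_0$. Let $G$ be a finite graph on $n$ vertices with maximum degree $\Delta(G)\leq\Delta$ and maximum codegree $\Delta_2(G)\leq C\Delta(\log\Delta)^{-c}$, where $C=2^{-7}$ and $c=7$. Then \[ \alpha(G)\geq(1-\varepsilon)\frac{n\log\Delta}{\Delta}. \]
   Context: For a graph $G$, $\alpha(G)$ is the size of a largest independent set, $\Delta(G)$ the maximum degree, and $\Delta_2(G)=\max_{u\neq v}|N(u)\cap N(v)|$ the maximum codegree (maximum number of common neighbours of two distinct vertices). $\log$ is the natural logarithm. *)

(* Defs.v *)
From Stdlib Require Import Reals.
From mathcomp Require Import all_boot.
Set Implicit Arguments. Unset Strict Implicit. Unset Printing Implicit Defensive.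

Definition simple_graph (T : finType) (e : rel T) : Prop :=
  symmetric e /\ irreflexive e.

Definition nbhd (T : finType) (e : rel T) (x : T) : {set T} := [set y | e x y].

Definition deg (T : finType) (e : rel T) (x : T) : nat := #|nbhd e x|.

Definition codeg (T : finType) (e : rel T) (u v : T) : nat :=
  #|nbhd e u :&: nbhd e v|.

Definition maxdeg (T : finType) (e : rel T) : nat := \max_(x : T) deg e x.
Definition maxcodeg (T : finType) (e : rel T) : nat :=
  \max_(p : T * T | p.1 != p.2) codeg e p.1 p.2.

Definition independent (T : finType) (e : rel T) (S : {set T}) : bool :=
  [forall x in S, forall y in S, ~~ e x y].

Definition alpha (T : finType) (e : rel T) : nat :=
  \max_(S : {set T} | independent e S) #|S|.

(* Main.v *)
(** A nibble, run on induced subgraphs [U] with degrees at most [D] and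
    codegrees at most [r * D], the ratio [r] being the same at every round.
    Select each vertex of [U] independently with probability [g / D]; keep the
    selected vertices without selected neighbours, and delete everything selected
    or adjacent to a selected vertex. An extra private coin makes every vertex
    survive with probability exactly [q = 1 - g - g^2]. For a set [W] of vertices
    (a neighbourhood or a common neighbourhood) the number of survivors is a
    decreasing function of the selection, and selecting [z] changes it by at most
    [t_z], the number of closed neighbourhoods of points of [W] containing [z].
    The upper tail is governed by the sum of [p_z * t_z^2] alone, with no maximum
    step size; expanding the square, this sum counts codegrees of pairs from [W],
    so it is at most about [r * g * |W|^2]. After removing the few vertices whose
    degree or some codegree is too large, the hypothesis holds again with [D]
    replaced by [(q + delta) * D] and the same [r].

    Linearity of expectation gives a recurrence for the guaranteed density [phi] of
    an independent set, solved by [phi D = (1 - 6 * g) * (ln D - ln Dmin) / D] with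
    [Dmin] a power of [ln Delta]. *)

From HB Require Import structures.
Require Import Defs.
From Stdlib Require Import Reals Lra.
From mathcomp Require Import all_boot.
Set Implicit Arguments. Unset Strict Implicit. Unset Printing Implicit Defensive.

Local Open Scope R_scope.

(** * Finite sums and products of reals *)

Lemma RplusA : associative Rplus. Proof. by move=> *; rewrite Rplus_assoc. Qed.
Lemma RmultA : associative Rmult. Proof. by move=> *; rewrite Rmult_assoc. Qed.
HB.instance Definition _ := Monoid.isComLaw.Build R 0 Rplus RplusA Rplus_comm Rplus_0_l.
HB.instance Definition _ := Monoid.isComLaw.Build R 1 Rmult RmultA Rmult_comm Rmult_1_l.
HB.instance Definition _ := Monoid.isMulLaw.Build R 0 Rmult Rmult_0_l Rmult_0_r.
HB.instance Definition _ := Monoid.isAddLaw.Build R Rmult Rplus Rmult_plus_distr_r Rmult_plus_distr_l.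

Local Notation "\rsum_ ( i 'in' A ) F" := (\big[Rplus/0]_(i in A) F)
  (at level 41, F at level 41, i, A at level 50).
Local Notation "\rsum_ i F" := (\big[Rplus/0]_i F)
  (at level 41, F at level 41, i at level 0).

Definition indic (b : bool) : R := if b then 1 else 0.

Lemma indic_ge0 b : 0 <= indic b. Proof. by case: b => /=; lra. Qed.

Lemma INR_addn m n : INR (m + n)%N = INR m + INR n.
Proof. exact: plus_INR. Qed.

Lemma INR_leq m n : (m <= n)%N -> INR m <= INR n.
Proof. by move=> /leP; apply: le_INR. Qed.

Section Sums.
Context {I : finType}.

Lemma rsum_le (P : pred I) (F G : I -> R) :
  (forall i, P i -> F i <= G i) ->
  \big[Rplus/0]_(i | P i) F i <= \big[Rplus/0]_(i | P i) G i.
Proof.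
move=> FG; elim/big_rec2: _ => [|i x y Pi xy]; first lra.
by have := FG i Pi; lra.
Qed.

Lemma rsum_const (A : {set I}) c : \rsum_(i in A) c = INR #|A| * c.
Proof.
rewrite big_const; elim: #|A| => [|n IH]; first by rewrite /=; lra.
by rewrite iterS IH S_INR; lra.
Qed.

Lemma rprod_const (A : {set I}) c : \big[Rmult/1]_(i in A) c = c ^ #|A|.
Proof. by rewrite big_const; elim: #|A| => [|n IH] //=; rewrite IH. Qed.

Lemma INR_sum (J : finType) (P : pred J) (F : J -> nat) :
  INR (\sum_(i | P i) F i)%N = \big[Rplus/0]_(i | P i) INR (F i).
Proof. by apply: (big_morph INR) => //; apply: INR_addn. Qed.

Lemma INR_card_indic (A : {set I}) : INR #|A| = \rsum_i indic (i \in A).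
Proof.
have -> : #|A| = (\sum_(i in A) 1)%N by rewrite sum1_card.
by rewrite INR_sum big_mkcond.
Qed.

Lemma INR_card_sub_indic (A : {set I}) (P : pred I) :
  INR #|[set i in A | P i]| = \rsum_(i in A) indic (P i).
Proof.
rewrite INR_card_indic [RHS]big_mkcond /=; apply: eq_bigr => i _.
by rewrite inE; case: (i \in A).
Qed.

End Sums.

(** * Product measures and a one-sided concentration inequality *)

Section Expectation.
Context {O : finType} (p : O -> R).
Context (p01 : forall z, 0 <= p z <= 1).

(* Expectation of [f (A :|: B)] for a random subset [B] of [s] containing each [z]
   independently with probability [p z]. *)
Fixpoint Ex (s : seq O) (f : {set O} -> R) (A : {set O}) : R :=
  if s is z :: s' then p z * Ex s' f (z |: A) + (1 - p z) * Ex s' f A else f A.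

Lemma Ex_eq s f g A : f =1 g -> Ex s f A = Ex s g A.
Proof. by move=> fg; elim: s A => //= z s IH A; rewrite !IH. Qed.

Lemma Ex_le s f g A : (forall B, f B <= g B) -> Ex s f A <= Ex s g A.
Proof.
move=> fg; elim: s A => //= z s IH A.
have := IH A; have := IH (z |: A); have := p01 z; nra.
Qed.

Lemma Ex_const s c A : Ex s (fun=> c) A = c.
Proof. by elim: s A => //= z s IH A; rewrite !IH; lra. Qed.

Lemma Ex_add s f g A : Ex s (fun B => f B + g B) A = Ex s f A + Ex s g A.
Proof. by elim: s A => //= z s IH A; rewrite !IH; lra. Qed.

Lemma Ex_scale s c f A : Ex s (fun B => c * f B) A = c * Ex s f A.
Proof. by elim: s A => //= z s IH A; rewrite !IH; lra. Qed.

Lemma Ex_sum (I : finType) (P : pred I) s (f : I -> {set O} -> R) A :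
  Ex s (fun B => \big[Rplus/0]_(i | P i) f i B) A =
  \big[Rplus/0]_(i | P i) Ex s (f i) A.
Proof.
elim: s A => //= z s IH A; rewrite !IH !big_distrr -big_split /=.
by apply: eq_bigr.
Qed.

Lemma Ex_witness s f A : exists B, Ex s f A <= f B.
Proof.
elim: s A => [|z s IH] A; first by exists A; apply: Rle_refl.
have [[B HB] [C HC]] := (IH (z |: A), IH A).
have pz := p01 z.
case: (Rle_dec (f B) (f C)) => [BC|/Rnot_le_lt CB] /=; [exists C | exists B]; nra.
Qed.

Lemma Ex_setU1 s f z A : Ex s f (z |: A) = Ex s (fun B => f (z |: B)) A.
Proof. by elim: s A => //= y s IH A; rewrite setUCA !IH. Qed.

(** Independence of the coordinates; every exact probability below is read off from it. The
    coordinates of [s] must start outside [A], since an element already in [A] is no longer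
    random. *)
Lemma Ex_prod s (g : O -> bool -> R) (A : {set O}) :
  uniq s -> {in s, forall z, z \notin A} ->
  Ex s (fun B => \big[Rmult/1]_z g z (z \in B)) A =
  \big[Rmult/1]_z (if z \in s then p z * g z true + (1 - p z) * g z false
                   else g z (z \in A)).
Proof.
elim: s A => [|z s IH] A //= /andP[zs us] sA.
rewrite !IH //.
- rewrite (bigD1 z) //= [in X in _ + X](bigD1 z) //= [RHS](bigD1 z) //=.
  rewrite (negPf zs) mem_head setU11 (negPf (sA z _)) ?mem_head //=.
  have eqr (F G : O -> R) : (forall y, y != z -> F y = G y) ->
      \big[Rmult/1]_(y | y != z) F y = \big[Rmult/1]_(y | y != z) G y.
    by move=> FG; apply: eq_bigr.
  set X := \big[Rmult/1]_(y | y != z) _; set Y := \big[Rmult/1]_(y | y != z) _.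
  set Z := \big[Rmult/1]_(y | y != z) _.
  have -> : X = Z.
    by apply: eqr => y yz; rewrite !inE (negPf yz).
  have -> : Y = Z.
    by apply: eqr => y yz; rewrite !inE (negPf yz).
  by ring.
- by move=> y ys; apply: sA; rewrite inE ys orbT.
move=> y ys; rewrite !inE negb_or sA ?inE ?ys ?orbT // andbT.
by apply: contraNneq zs => <-.
Qed.

Lemma prod_indic (P : pred O) (b : pred O) :
  \big[Rmult/1]_(z | P z) indic (b z) = indic [forall z, P z ==> b z].
Proof.
case: (boolP [forall z, P z ==> b z]) => [/forallP h|].
  by apply: big1 => z Pz; have := h z; rewrite Pz /= => ->.
by rewrite negb_forall => /existsP[z]; rewrite negb_imply => /andP[Pz /negPf bz];
  rewrite (bigD1 z) //= bz /= Rmult_0_l.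
Qed.

Lemma disjoint_forall (S B : {set O}) :
  [disjoint S & B] = [forall z, (z \in S) ==> (z \notin B)].
Proof.
rewrite disjoint_subset; apply/subsetP/forallP => h z.
  by apply/implyP => /h; rewrite inE.
by move=> zS; have /implyP/(_ zS) := h z; rewrite inE.
Qed.

Lemma Ex_disjoint (S : {set O}) :
  Ex (enum O) (fun B => indic [disjoint S & B]) set0 =
  \big[Rmult/1]_(z in S) (1 - p z).
Proof.
rewrite (@Ex_eq _ _ (fun B => \big[Rmult/1]_z (if z \in S then indic (z \notin B) else 1))).
  rewrite (Ex_prod (fun z b => if z \in S then indic (~~ b) else 1)) ?enum_uniq //; last first.
    by move=> z _; rewrite inE.
  rewrite [RHS]big_mkcond /=; apply: eq_bigr => z _.
  by rewrite mem_enum /=; case: (z \in S) => /=; lra.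
move=> B; rewrite -big_mkcond prod_indic; congr indic.
by rewrite disjoint_forall.
Qed.

Lemma Ex_in_disjoint (v : O) (S : {set O}) : v \notin S ->
  Ex (enum O) (fun B => indic ((v \in B) && [disjoint S & B])) set0 =
  p v * \big[Rmult/1]_(z in S) (1 - p z).
Proof.
move=> vS.
pose g z b := if z == v then indic b else if z \in S then indic (~~ b) else 1.
rewrite (@Ex_eq _ _ (fun B => \big[Rmult/1]_z g z (z \in B))).
  rewrite Ex_prod ?enum_uniq //; last by move=> z _; rewrite inE.
  rewrite (bigD1 v) //= mem_enum /= /g eqxx /=; congr (_ * _); first lra.
  rewrite [RHS]big_mkcond [RHS](bigD1 v) //= (negPf vS) Rmult_1_l.
  apply: eq_bigr => z /negPf zv; rewrite mem_enum zv /=.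
  by case: (z \in S) => /=; lra.
move=> B; rewrite (bigD1 v) //= {1}/g eqxx.
have -> : \big[Rmult/1]_(z | z != v) g z (z \in B) = \big[Rmult/1]_(z in S) indic (z \notin B).
  rewrite [RHS]big_mkcond [RHS](bigD1 v) //= (negPf vS) Rmult_1_l.
  by apply: eq_bigr => z /negPf zv; rewrite /g zv.
rewrite prod_indic; case: (v \in B) => /=; last lra.
rewrite Rmult_1_l; congr indic.
by rewrite disjoint_forall.
Qed.

(** From [exp c >= 1 + c] and [(1 + c) * (1 - c + c ^ 2) = 1 + c ^ 3 >= 1]. *)
Lemma exp_neg_le_quadratic c : 0 <= c -> exp (- c) <= 1 - c + c ^ 2.
Proof.
move=> c0; have ec := exp_ineq1_le c; have e0 := exp_pos (- c).
have : exp (- c) * exp c = 1 by rewrite -exp_plus Rplus_opp_l exp_0.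
by have : 0 <= c ^ 3 := pow_le _ 3 c0; nra.
Qed.

Lemma exp_monotone x y : x <= y -> exp x <= exp y.
Proof.
case=> [xy|->]; last exact: Rle_refl.
exact/Rlt_le/exp_increasing.
Qed.

(* Only decrements [b - a >= 0] occur, which makes the bound valid for all [l >= 0]:
   no bound on the step size is needed. *)
Lemma bernoulli_mgf q a b l t : 0 <= q <= 1 -> 0 <= l -> 0 <= b - a <= t ->
  q * exp (l * a) + (1 - q) * exp (l * b) <=
  exp (l * (q * a + (1 - q) * b) + l ^ 2 * (q * t ^ 2)).
Proof.
move=> q01 l0 [ba bt].
set c := l * (b - a).
have c0 : 0 <= c by rewrite /c; nra.
have -> : l * a = l * b + - c by rewrite /c; ring.
have E : l * b + (- (q * c) + q * c ^ 2)
    <= l * (q * a + (1 - q) * b) + l ^ 2 * (q * t ^ 2).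
  have : (b - a) ^ 2 <= t ^ 2 by nra.
  have : 0 <= l ^ 2 * q by nra.
  by rewrite /c; nra.
apply: Rle_trans (exp_monotone E); rewrite (exp_plus (l * b) (- c)).
rewrite (exp_plus (l * b) (_ + _)).
have hX := exp_ineq1_le (- (q * c) + q * c ^ 2).
have := exp_pos (l * b); have := exp_neg_le_quadratic c0; move=> hq.
have : q * exp (- c) + (1 - q) <= exp (- (q * c) + q * c ^ 2) by nra.
by nra.
Qed.

(** The coordinates are revealed one at a time. The two conditional expectations of [f] after
    revealing [z] differ by at most [t z], so [bernoulli_mgf] applies to them and the variance terms
    add up. *)
Lemma Ex_mgf s f t l A : 0 <= l ->
  (forall B z, 0 <= f B - f (z |: B) <= t z) ->
  Ex s (fun B => exp (l * f B)) A <=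
  exp (l * Ex s f A + l ^ 2 * \big[Rplus/0]_(z <- s) (p z * t z ^ 2)).
Proof.
move=> l0 ft; elim: s A => [|z s IH] A /=.
  by rewrite big_nil Rmult_0_r Rplus_0_r; apply: Rle_refl.
rewrite big_cons; set V := \big[Rplus/0]_(y <- s) _.
have pz := p01 z.
have d : 0 <= Ex s f A - Ex s f (z |: A) <= t z.
  rewrite Ex_setU1; split.
    suff : Ex s (fun B => f (z |: B)) A <= Ex s f A by lra.
    by apply: Ex_le => B; have := ft B z; lra.
  suff : Ex s f A <= Ex s (fun B => f (z |: B) + t z) A.
    by rewrite Ex_add Ex_const; lra.
  by apply: Ex_le => B; have := ft B z; lra.
have := bernoulli_mgf pz l0 d.
set m := exp (l * (p z * _ + _) + _) => Hm.
apply: (Rle_trans _ (m * exp (l ^ 2 * V))); last first.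
  by rewrite /m -exp_plus; apply: exp_monotone; apply: Req_le; ring.
have := IH A; have := IH (z |: A); rewrite !exp_plus -/V.
by have := exp_pos (l ^ 2 * V); nra.
Qed.

Lemma Ex_upper_tail s f t A m d V :
  (forall B z, 0 <= f B - f (z |: B) <= t z) ->
  Ex s f A <= m -> \big[Rplus/0]_(z <- s) (p z * t z ^ 2) <= V -> 0 < V -> 0 <= d ->
  Ex s (fun B => indic (Rlt_dec (m + d) (f B))) A <= exp (- (d ^ 2 / (4 * V))).
Proof.
(* This [l] minimizes the Chernoff exponent [- l * d + l ^ 2 * V], with value
   [- d ^ 2 / (4 * V)]. *)
move=> ft fm HV V0 d0; pose l := d / (2 * V).
have l0 : 0 <= l by apply: Rmult_le_pos => //; apply/Rlt_le/Rinv_0_lt_compat; lra.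
apply: (Rle_trans _ (Ex s (fun B => exp (- (l * (m + d))) * exp (l * f B)) A)).
  apply: Ex_le => B; rewrite -exp_plus; case: Rlt_dec => [lt|_] /=; last exact/Rlt_le/exp_pos.
  have := exp_ineq1_le (- (l * (m + d)) + l * f B); nra.
rewrite Ex_scale; apply: (Rle_trans _ (exp (- (l * (m + d))) * exp (l * m + l ^ 2 * V))).
  apply: Rmult_le_compat_l; first exact/Rlt_le/exp_pos.
  apply: Rle_trans (Ex_mgf s A l0 ft) _; apply: exp_monotone.
  have : 0 <= l ^ 2 by nra.
  by nra.
rewrite -exp_plus; apply: exp_monotone; apply: Req_le; rewrite /l; field; lra.
Qed.

End Expectation.

(** * Upper tail for the number of survivors in a fixed set *)

Section Survivors.
Context {O T : finType} (pr : O -> R) (S : T -> {set O}).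
Context (pr01 : forall z, 0 <= pr z <= 1).

Definition survivors (W : {set T}) (B : {set O}) : {set T} :=
  [set w in W | [disjoint S w & B]].

Lemma survivors_setU1 W B z :
  0 <= INR #|survivors W B| - INR #|survivors W (z |: B)|
    <= INR #|[set w in W | z \in S w]|.
Proof.
rewrite !INR_card_sub_indic.
set X := \big[Rplus/0]_(i in W) _; set Y := \big[Rplus/0]_(i in W) _.
set Z := \big[Rplus/0]_(i in W) _.
have disjE w : [disjoint S w & z |: B] = (z \notin S w) && [disjoint S w & B].
  by rewrite ![[disjoint S w & _]]disjoint_sym -!setI_eq0 setIUl setU_eq0
    !setI_eq0 disjoints1.
have le1 : Y <= X.
  apply: rsum_le => w _; rewrite disjE.
  by case: (z \in S w); case: [disjoint _ & _] => /=; lra.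
have : X <= Y + Z.
  rewrite -big_split /=; apply: rsum_le => w _; rewrite disjE.
  by case: (z \in S w); case: [disjoint _ & _] => /=; lra.
by lra.
Qed.

(** Expanding the square counts pairs of points of [W] with a common blocking element, which is how
    codegrees enter the variance. *)
Lemma sum_sqr_multiplicity (W : {set T}) :
  \big[Rplus/0]_(z <- enum O) (pr z * INR #|[set w in W | z \in S w]| ^ 2) =
  \rsum_(w in W) \rsum_(w' in W) \rsum_(z in S w :&: S w') pr z.
Proof.
rewrite big_enum /=.
under [RHS]eq_bigr => w _.
  under eq_bigr => w' _ do rewrite big_mkcond /=.
  rewrite exchange_big /=; over.
rewrite exchange_big /=; apply: eq_bigr => z _.
rewrite INR_card_sub_indic /= Rmult_1_r big_distrl /= big_distrr /=.
apply: eq_bigr => w _; rewrite !big_distrr /=; apply: eq_bigr => w' _.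
by rewrite inE; case: (z \in S w); case: (z \in S w') => /=; lra.
Qed.

Lemma Ex_survivors (W : {set T}) q :
  {in W, forall w, \big[Rmult/1]_(z in S w) (1 - pr z) = q} ->
  Ex pr (enum O) (fun B => INR #|survivors W B|) set0 = INR #|W| * q.
Proof.
move=> Sq; rewrite -rsum_const.
under Ex_eq => B do rewrite INR_card_sub_indic.
by rewrite Ex_sum; apply: eq_bigr => w /Sq; rewrite Ex_disjoint.
Qed.

Lemma survivors_upper_tail (W : {set T}) q M V d :
  {in W, forall w, \big[Rmult/1]_(z in S w) (1 - pr z) = q} ->
  0 <= q -> INR #|W| <= M -> 0 < V -> 0 <= d ->
  \rsum_(w in W) \rsum_(w' in W) \rsum_(z in S w :&: S w') pr z <= V ->
  Ex pr (enum O) (fun B => indic (Rlt_dec (q * M + d) (INR #|survivors W B|))) set0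
    <= exp (- (d ^ 2 / (4 * V))).
Proof.
move=> Sq q0 WM V0 d0 HV.
apply: (Ex_upper_tail pr01) (fun B z => survivors_setU1 W B z) _ _ V0 d0.
  by rewrite (Ex_survivors Sq); nra.
by rewrite sum_sqr_multiplicity.
Qed.

End Survivors.

(** * Sparse induced subgraphs and the random selection *)

Section Nibble.
Context {T : finType} (e : rel T) (e_sym : symmetric e) (e_irr : irreflexive e).

Definition sparse (r D : R) (U : {set T}) : Prop :=
  {in U, forall v, INR #|nbhd e v :&: U| <= D} /\
  {in U &, forall u v, u != v -> INR #|nbhd e u :&: nbhd e v :&: U| <= r * D}.

Definition has_independent (U : {set T}) (x : R) : Prop :=
  exists I : {set T}, [/\ I \subset U, independent e I & x <= INR #|I|].

Definition cnbhd (U : {set T}) (w : T) := w |: (nbhd e w :&: U).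

(* Vertices are encoded as [(true, v)] (selection of [v]) and [(false, v)] (the private
   coin of [v]); [w] survives when no element of [blockers U w] is drawn. *)
Definition blockers (U : {set T}) (w : T) : {set bool * T} :=
  (false, w) |: [set (true, z) | z in cnbhd U w].

(** Avoiding all selections in its closed neighbourhood has probability [(1 - p) ^ #|cnbhd U w|];
    the coin of [w] is biased to bring this down to exactly [q]. Outside [U], where no degree bound
    is known, the coin has the default probability 0. *)
Definition nibble_prob (p q : R) (U : {set T}) (x : bool * T) : R :=
  if x.1 then p else if x.2 \in U then 1 - q / (1 - p) ^ #|cnbhd U x.2| else 0.

Lemma card_cnbhd U w : #|cnbhd U w| = #|nbhd e w :&: U|.+1.
Proof. by rewrite cardsU1 !inE e_irr. Qed.

Lemma true_inj : injective (fun z : T => (true, z)).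
Proof. by move=> x y []. Qed.

Lemma blockers_false U w : (false, w) \notin [set (true, z) | z in cnbhd U w].
Proof. by apply/imsetP => -[]. Qed.

Lemma blockersE U w b z :
  ((b, z) \in blockers U w) = if b then z \in cnbhd U w else z == w.
Proof.
rewrite in_setU1; case: b; last first.
  rewrite xpair_eqE eqxx /=; case: (z == w) => //=.
  by apply/imsetP => -[].
by rewrite xpair_eqE /= mem_imset //; apply: true_inj.
Qed.

Lemma blockers_avoid p q (U : {set T}) w : p < 1 -> w \in U ->
  \big[Rmult/1]_(x in blockers U w) (1 - nibble_prob p q U x) = q.
Proof.
move=> p1 wU; rewrite big_setU1 ?blockers_false //=.
rewrite big_imset /=; last by move=> x y _ _ [].
rewrite /nibble_prob /= rprod_const wU.
have : (1 - p) ^ #|cnbhd U w| <> 0 by apply: pow_nonzero; lra.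
by move=> h; field.
Qed.

Lemma blockers_overlap p q (U : {set T}) w w' : w != w' ->
  \rsum_(x in blockers U w :&: blockers U w') nibble_prob p q U x =
  INR #|cnbhd U w :&: cnbhd U w'| * p.
Proof.
move=> ww'.
have -> : blockers U w :&: blockers U w' =
          [set (true, z) | z in cnbhd U w :&: cnbhd U w'].
  apply/setP => -[b z]; rewrite in_setI !blockersE; case: b; last first.
    have /negPf-> : (false, z) \notin [set (true, z) | z in cnbhd U w :&: cnbhd U w'].
      by apply/imsetP => -[].
    by apply/negbTE/negP => /andP[/eqP-> /eqP wE]; rewrite wE eqxx in ww'.
  by rewrite (mem_imset _ _ true_inj) in_setI.
by rewrite big_imset /=; [rewrite /nibble_prob /= rsum_const | move=> x y _ _ []].
Qed.

Lemma card_cnbhd_inter U w w' :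
  (#|cnbhd U w :&: cnbhd U w'| <= #|nbhd e w :&: nbhd e w' :&: U| + 2)%N.
Proof.
apply: (@leq_trans #|w |: (w' |: (nbhd e w :&: nbhd e w' :&: U))|).
  apply/subset_leq_card/subsetP => z; rewrite !inE.
  by case: (z == w); case: (z == w'); case: (z \in U); rewrite ?andbT ?andbF ?orbF.
by rewrite !cardsU1 addnA addnC leq_add2l; do 2!case: (_ \notin _).
Qed.

Lemma bernoulli_ineq x n : 0 <= x <= 1 -> 1 - INR n * x <= (1 - x) ^ n.
Proof.
move=> x01; elim: n => [|n IH]; first by rewrite /=; lra.
rewrite S_INR /=; have := pos_INR n; have := pow_le (1 - x) n; nra.
Qed.

(** A coin needs [q <= (1 - p) ^ (d + 1)] with [d <= D]. By Bernoulli's inequality the power is at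
    least [1 - g - p], and [p <= g ^ 2] because [1 <= g * D]; hence the term [g ^ 2] in [q]. *)
Lemma nibble_prob01 g D (U : {set T}) x : 0 < g <= 1 / 10 -> 1 <= g * D ->
  {in U, forall v, INR #|nbhd e v :&: U| <= D} ->
  0 <= nibble_prob (g / D) (1 - g - g ^ 2) U x <= 1.
Proof.
move=> g0 gD degU; have D0 : 0 < D by nra.
have pD : g / D * D = g by field; lra.
set p := g / D in pD *.
have p0 : 0 <= p <= g ^ 2 by nra.
rewrite /nibble_prob; case: ifP => _; first nra.
case: ifP => [wU|_]; last lra.
have dw := degU _ wU; have := pos_INR #|nbhd e x.2 :&: U| => d0.
have := @bernoulli_ineq p #|cnbhd U x.2|; rewrite card_cnbhd S_INR => B.
have {}B : 1 - g - g ^ 2 <= (1 - p) ^ #|nbhd e x.2 :&: U|.+1 by have := B; nra.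
set y := (1 - p) ^ _ in B *.
have y0 : 0 < y by nra.
have -> : 1 - (1 - g - g ^ 2) / y = (y - (1 - g - g ^ 2)) / y by field; lra.
split; first by apply: Rle_mult_inv_pos; lra.
apply: (Rmult_le_reg_r y) => //; rewrite /Rdiv Rmult_assoc Rinv_l; nra.
Qed.

Lemma overlap_sum_le p q r D M (U W : {set T}) :
  (forall x, 0 <= nibble_prob p q U x <= 1) -> 0 <= p -> p * (D + 1) <= 2 ->
  0 <= r * D -> sparse r D U -> W \subset U -> INR #|W| <= M ->
  \rsum_(w in W) \rsum_(w' in W)
    \rsum_(x in blockers U w :&: blockers U w') nibble_prob p q U x
  <= M ^ 2 * (p * (r * D + 2)) + 3 * M.
Proof.
move=> pr01 p0 pD rD [degU codU] /subsetP WU WM.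
apply: (Rle_trans _ (\rsum_(w in W) (INR #|W| * (p * (r * D + 2)) + 3))); last first.
  have W0 := pos_INR #|W|; rewrite rsum_const.
  have : 0 <= p * (r * D + 2) by nra.
  have : INR #|W| ^ 2 <= M ^ 2 by nra.
  by nra.
apply: rsum_le => w wW.
apply: (Rle_trans _ (\rsum_(w' in W) (p * (r * D + 2) + 3 * indic (w' == w)))); last first.
  rewrite big_split /= rsum_const -big_distrr /= -INR_card_sub_indic.
  have -> : [set i in W | i == w] = [set w].
    by apply/setP => i; rewrite !inE; case: eqP => [->|_]; rewrite ?wW ?andbF.
  by rewrite cards1 /=; lra.
apply: rsum_le => w' w'W; case: (eqVneq w' w) => [->|ww'] /=.
  (* On the diagonal the coin contributes at most 1 and the selections at most [p * (D + 1) <= 2]: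
     this is the 3. Off the diagonal the private coins are distinct and only common selections
     count. *)
  rewrite setIid big_setU1 ?blockers_false //= big_imset /=; last by move=> x y _ _ [].
  rewrite [X in _ + X](eq_bigr (fun=> p)) // rsum_const card_cnbhd S_INR.
  have := pr01 (false, w); have := degU _ (WU _ wW).
  by have := pos_INR #|nbhd e w :&: U|; nra.
rewrite blockers_overlap 1?eq_sym //.
have := INR_leq (card_cnbhd_inter U w w'); rewrite INR_addn /=.
have := codU _ _ (WU _ wW) (WU _ w'W); rewrite eq_sym => /(_ ww').
by nra.
Qed.

(** * One round of the nibble *)

Section Step.
Context {g delta r D : R} {U : {set T}}.
Context (g_small : 0 < g <= 1 / 10) (delta0 : 0 < delta) (r01 : 0 < r <= 1).
Context (rD_large : 3 <= r ^ 2 * D) (gD_large : 1 <= g * D).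
Context (U_sparse : sparse r D U).

Let q := 1 - g - g ^ 2.
Let p := g / D.
Let pr := nibble_prob p q U.
Let E f := Ex pr (enum {: bool * T}) f set0.
Let eta := exp (- (delta ^ 2 / (8 * r))).
Let alive (W : {set T}) (B : {set bool * T}) := survivors (blockers U) W B.

Let D_gt0 : 0 < D. Proof. by move: gD_large g_small; nra. Qed.
Let pD : p * D = g. Proof. by rewrite /p; field; apply: Rgt_not_eq. Qed.
Let p_small : 0 < p <= g ^ 2.
Proof. by move: gD_large g_small pD D_gt0; nra. Qed.
Let pr01 x : 0 <= pr x <= 1.
Proof. by case: U_sparse => degU _; apply: nibble_prob01. Qed.
Let rD_ge3 : 3 <= r * D.
Proof. by move: rD_large r01; nra. Qed.

(** The variance proxy is [2 * r * M ^ 2]: the off-diagonal part is controlled by [3 * p <= g * r],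
    and the diagonal [3 * M] is at most [r * M ^ 2] since [r * M >= r ^ 2 * D >= 3]. With deviation
    [delta * M] the exponent no longer depends on [M], so the same [eta] serves degrees ([M = D])
    and codegrees ([M = r * D]). *)
Lemma alive_upper_tail (W : {set T}) M :
  W \subset U -> INR #|W| <= M -> r * D <= M ->
  E (fun B => indic (Rlt_dec ((q + delta) * M) (INR #|alive W B|))) <= eta.
Proof.
move=> WU WM rDM; have [pD' D1] := (pD, rD_ge3).
have M0 : 3 <= r * M by move: rD_large r01; nra.
have V0 : 0 < 2 * r * M ^ 2 by move: r01; nra.
have -> : (q + delta) * M = q * M + delta * M by ring.
have -> : eta = exp (- ((delta * M) ^ 2 / (4 * (2 * r * M ^ 2)))).
  by rewrite /eta; congr (exp (- _)); field; split; nra.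
apply: (survivors_upper_tail pr01) => //.
- by move=> w /(subsetP WU) wU; apply: blockers_avoid => //; move: p_small g_small; nra.
- by rewrite /q; move: g_small; nra.
- by move: delta0; nra.
apply: Rle_trans (overlap_sum_le pr01 _ _ _ U_sparse WU WM) _; [by move: p_small; lra| |lra|].
  by move: p_small g_small; nra.
have -> : p * (r * D + 2) = g * r + 2 * p by rewrite -pD; ring.
have : 3 * p <= g * r by rewrite -pD; move: p_small; nra.
by move: g_small r01; nra.
Qed.

Let picked (B : {set bool * T}) :=
  [set v in U | ((true, v) \in B) &&
                [disjoint [set (true, z) | z in nbhd e v :&: U] & B]].
Let common u v := nbhd e u :&: nbhd e v :&: U.
(** Pairs without a common neighbour in [U] keep codegree 0, so the union bound runs over partners
    only and its cost is polynomial in [D], whatever the size of [U]. *)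
Let partners v := [set u in U | (u != v) && (common u v != set0)].
Let crowded W M B : bool := Rlt_dec ((q + delta) * M) (INR #|alive W B|).
Let rest (B : {set bool * T}) :=
  [set v in U | [&& [disjoint blockers U v & B], ~~ crowded (nbhd e v :&: U) D B
                  & [forall u in partners v, ~~ crowded (common u v) (r * D) B]]].

Lemma rest_sparse B : sparse r ((q + delta) * D) (rest B).
Proof.
have alive_rest (W : {set T}) : W :&: rest B \subset alive (W :&: U) B.
  by apply/subsetP => w; rewrite !inE => /and4P[-> -> -> _].
have le_crowded (W : {set T}) M : ~~ crowded (W :&: U) M B ->
    INR #|W :&: rest B| <= (q + delta) * M.
  rewrite /crowded; case: Rlt_dec => //= /Rnot_lt_le le _.
  exact: Rle_trans (INR_leq (subset_leq_card (alive_rest W))) le.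
split=> [v|u v].
  by rewrite inE => /and4P[_ _ /le_crowded].
rewrite [u \in _]inE => /andP[uU _]; rewrite inE => /and4P[vU _ _ /forall_inP cr] uv.
(* Codegrees shrink by the same factor as degrees, so the ratio [r] is preserved. *)
have -> : r * ((q + delta) * D) = (q + delta) * (r * D) by ring.
case: (boolP (u \in partners v)) => [/cr/le_crowded //|].
rewrite inE uU uv /= negbK => /eqP c0.
have -> : #|nbhd e u :&: nbhd e v :&: rest B| = 0%N.
  apply/eqP; rewrite cards_eq0 -subset0 -c0 /common; apply: setIS.
  by apply/subsetP => w; rewrite inE => /andP[].
rewrite /=; apply: Rmult_le_pos; last by move: rD_ge3; lra.
by rewrite /q; move: g_small delta0; nra.
Qed.

(** A surviving vertex has no selected vertex in its closed neighbourhood, so it is neither equal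
    nor adjacent to a picked one. *)
Lemma picked_rest_independent B (I : {set T}) :
  I \subset rest B -> independent e I ->
  independent e (picked B :|: I) /\ INR #|picked B :|: I| = INR #|picked B| + INR #|I|.
Proof.
move=> /subsetP IR Iind.
have apart v w : v \in picked B -> w \in rest B -> (w != v) && ~~ e w v.
  rewrite inE => /and3P[vU vB _]; rewrite inE => /and4P[_ dis _ _].
  rewrite -negb_or; apply/negP => h.
  have vb : (true, v) \in blockers U w.
    rewrite blockersE !inE vU andbT eq_sym; exact: h.
  by have := disjointFr dis vb; rewrite vB.
split.
  apply/forall_inP => x xS; apply/forall_inP => y yS; apply/negP => exy.
  move: xS yS; rewrite !in_setU => /orP[xP|xI] /orP[yP|yI].
  - move: xP; rewrite inE => /and3P[xU _ dis].
    move: yP; rewrite inE => /and3P[yU yB _].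
    have : (true, y) \in [set (true, z) | z in nbhd e x :&: U].
      by rewrite (mem_imset _ _ true_inj) !inE exy yU.
    by move/(disjointFr dis); rewrite yB.
  - by have := apart _ _ xP (IR _ yI); rewrite e_sym exy andbF.
  - by have := apart _ _ yP (IR _ xI); rewrite exy andbF.
  - by move/forall_inP: Iind => /(_ x xI)/forall_inP/(_ y yI); rewrite exy.
rewrite -INR_addn cardsU; congr INR.
suff -> : picked B :&: I = set0 by rewrite cards0 subn0.
apply/setP => x; rewrite !in_setI in_set0; apply/negbTE/negP => /andP[xP /IR xR].
by have := apart _ _ xP xR; rewrite eqxx.
Qed.

(** Each partner is the end of a path of length two from [v] inside [U], and there are at most
    [D ^ 2] such walks. *)
Lemma card_partners v : v \in U -> INR #|partners v| <= D ^ 2.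
Proof.
case: U_sparse => degU _ vU; have dv := degU _ vU.
apply: (Rle_trans _ (\rsum_(w in nbhd e v :&: U) INR #|nbhd e w :&: U|)); last first.
  apply: (Rle_trans _ (\rsum_(w in nbhd e v :&: U) D)).
    by apply: rsum_le => w; rewrite inE => /andP[_ /degU].
  by rewrite rsum_const; move: D_gt0; nra.
under eq_bigr => w _ do rewrite INR_card_indic.
rewrite exchange_big INR_card_indic /=; apply: rsum_le => u _.
have sum0 (P : pred T) (F : T -> bool) : 0 <= \big[Rplus/0]_(w | P w) indic (F w).
  elim/big_rec: _ => [|w x _ x0]; first lra.
  by have := indic_ge0 (F w); lra.
case: (boolP (u \in partners v)) => [|_] /=; last exact: sum0.
rewrite inE => /and3P[uU _ /set0Pn[w]]; rewrite !inE => /andP[/andP[uw vw] wU].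
rewrite (bigD1 w) /=; last by rewrite !inE vw.
rewrite !inE e_sym uw uU /=.
by have := sum0 (fun i => (i \in nbhd e v :&: U) && (i != w)) (fun i => u \in nbhd e i :&: U); lra.
Qed.

(** Union bound in pointwise form: a survivor is lost only if at least one bad event occurs, and
    each bad event subtracts 1. *)
Lemma card_rest_ge (B : {set bool * T}) :
  \rsum_(v in U) (indic [disjoint blockers U v & B] + - 1 *
     (indic (crowded (nbhd e v :&: U) D B) +
      \rsum_(u in partners v) indic (crowded (common u v) (r * D) B)))
  <= INR #|rest B|.
Proof.
rewrite INR_card_sub_indic; apply: rsum_le => v vU.
set s := \big[Rplus/0]_(u in _) _.
have s0 : 0 <= s.
  rewrite /s; elim/big_rec: _ => [|w x _ x0]; first lra.
  by have := indic_ge0 (crowded (common w v) (r * D) B); lra.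
case: [disjoint _ & _] => /=; last first.
  by have := indic_ge0 (crowded (nbhd e v :&: U) D B); lra.
case: (crowded _ _ _) => /=; first by have := indic_ge0 false; rewrite /=; lra.
case: (boolP [forall u in _, _]) => /= [_|]; first lra.
rewrite negb_forall_in => /exists_inP[u uv]; rewrite negbK => cr.
suff : 1 <= s by lra.
rewrite /s (bigD1 u) //= cr /=.
set x := \big[Rplus/0]_(i | _) _.
suff : 0 <= x by lra.
rewrite /x; elim/big_rec: _ => [|w y _ y0]; first lra.
by have := indic_ge0 (crowded (common w v) (r * D) B); lra.
Qed.

Lemma nibble_step phi : 0 <= phi ->
  (forall U', sparse r ((q + delta) * D) U' -> has_independent U' (phi * INR #|U'|)) ->
  has_independent U
    ((g / D * (1 - g) + phi * (q - (1 + D ^ 2) * eta)) * INR #|U|).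
Proof.
move=> phi0 IH; have [degU codU] := U_sparse; have [ps pD'] := (p_small, pD).
pose F v (B : {set bool * T}) := indic (((true, v) \in B) &&
                [disjoint [set (true, z) | z in nbhd e v :&: U] & B]) + phi *
  (indic [disjoint blockers U v & B] + - 1 *
     (indic (crowded (nbhd e v :&: U) D B) +
      \rsum_(u in partners v) indic (crowded (common u v) (r * D) B))).
(* Per vertex: the chance of being picked is at least [p * (1 - p * D)], the chance of survival is
   [q], and there are at most [1 + D ^ 2] bad events of probability at most [eta]. *)
have EF v : v \in U -> p * (1 - g) + phi * (q - (1 + D ^ 2) * eta) <= E (F v).
  move=> vU; have dv := degU _ vU.
  rewrite /E /F !(Ex_add, Ex_scale) Ex_sum Ex_in_disjoint; last first.
    by rewrite (mem_imset _ _ true_inj) !inE e_irr.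
  rewrite Ex_disjoint blockers_avoid //; last by nra.
  rewrite big_imset /=; last by move=> x y _ _ [].
  rewrite (eq_bigr (fun=> 1 - p)) // rprod_const.
  have B := @bernoulli_ineq p #|nbhd e v :&: U|.
  have {}B : p * (1 - g) <= p * (1 - p) ^ #|nbhd e v :&: U|.
    apply: Rmult_le_compat_l; first lra.
    have d0 := pos_INR #|nbhd e v :&: U|.
    have {}B : 1 - INR #|nbhd e v :&: U| * p <= (1 - p) ^ #|nbhd e v :&: U|.
      by apply: B; nra.
    by nra.
  have t1 := @alive_upper_tail (nbhd e v :&: U) D (subsetIr _ _) dv.
  have {}t1 := t1 ltac:(move: r01 D_gt0; nra).
  have t2 : \rsum_(u in partners v)
      E (fun B => indic (crowded (common u v) (r * D) B)) <= D ^ 2 * eta.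
    apply: (Rle_trans _ (\rsum_(u in partners v) eta)).
      apply: rsum_le => u; rewrite inE => /and3P[uU uv _].
      apply: alive_upper_tail; [exact: subsetIr|exact: codU|exact: Rle_refl].
    rewrite rsum_const; apply: Rmult_le_compat_r; first exact/Rlt_le/exp_pos.
    exact: card_partners.
  rewrite /E in t1 t2; rewrite -/pr.
  apply: Rplus_le_compat B _; apply: Rmult_le_compat_l => //.
  rewrite /crowded in t2 *; lra.
have [B HB] := Ex_witness pr01 (enum {: bool * T}) (fun B => \rsum_(v in U) F v B) set0.
have [I [IR Iind cI]] := IH _ (rest_sparse B).
have [ind card] := picked_rest_independent IR Iind.
exists (picked B :|: I); split=> //.
  rewrite subUset; apply/andP; split.
    by apply/subsetP => v; rewrite inE => /andP[].
  by apply: subset_trans IR _; apply/subsetP => v; rewrite inE => /andP[].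
rewrite card; apply: (Rle_trans _ (\rsum_(v in U) F v B)).
  apply: Rle_trans HB; rewrite Ex_sum Rmult_comm -rsum_const.
  by apply: rsum_le => v /EF.
rewrite /F big_split /= -INR_card_sub_indic -big_distrr /=.
have := card_rest_ge B; set s := \big[Rplus/0]_(v in U) _ => hs.
by rewrite -/(picked B); nra.
Qed.

End Step.

End Nibble.

(** * Logarithmic estimates and the density recurrence *)

Lemma ln_monotone x y : 0 < x -> x <= y -> ln x <= ln y.
Proof.
move=> x0 [xy|->]; last exact: Rle_refl.
exact/Rlt_le/ln_increasing.
Qed.

Lemma ln_le_self x : 0 < x -> ln x <= x.
Proof. by move=> x0; have := exp_ineq1_le (ln x); rewrite exp_ln //; lra. Qed.

Lemma ln_ge_quadratic g Q : 0 < g <= 1 / 10 -> 1 - g - g ^ 2 <= Q ->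
  - (g + 4 * g ^ 2) <= ln Q.
Proof.
move=> g0 gQ; rewrite -[X in X <= _]ln_exp; apply: ln_monotone; first exact: exp_pos.
have := @exp_neg_le_quadratic (g + 4 * g ^ 2); have : 0 <= g + 4 * g ^ 2 by nra.
move=> h /(_ h) {h}; nra.
Qed.

Section Density.
Context {T : finType} (e : rel T) (e_sym : symmetric e) (e_irr : irreflexive e).

Lemma has_independent_le (U : {set T}) x y :
  x <= y -> has_independent e U y -> has_independent e U x.
Proof. by move=> xy [I [IU ind yI]]; exists I; split=> //; apply: Rle_trans yI. Qed.

Lemma has_independent_le0 (U : {set T}) x : x <= 0 -> has_independent e U x.
Proof.
move=> x0; exists set0; split; [exact: sub0set| |by rewrite cards0].
by apply/forall_inP => y; rewrite inE.
Qed.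

Context {g L : R} (g_small : 0 < g <= 1 / 10) (L_large : 8 <= g ^ 2 * L).

Let r := / (128 * L ^ 7).
(** Chosen so that [4 * L * delta = g ^ 2], the relative loss that one round of the recurrence can
    absorb. *)
Let delta := g ^ 2 / (4 * L).
Let Q := 1 - g - g ^ 2 + delta.
(* [Dmin = 3 / r^2]: below it the diagonal terms dominate the variance. *)
Let Dmin := 49152 * L ^ 14.

Let L_ge800 : 800 <= L.
Proof.
have g2 : 0 < g ^ 2 <= 1 / 100 by move: g_small; nra.
have L0 : 0 < L by move: L_large; nra.
by move: L_large; nra.
Qed.
Let deltaL : delta * L = g ^ 2 / 4.
Proof. by rewrite /delta; move: L_ge800 => h; field; lra. Qed.
Let delta_gt0 : 0 < delta.
Proof. by move: deltaL L_ge800 g_small; nra. Qed.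
Let Q_bounds : 1 / 2 <= Q < 1.
Proof. by rewrite /Q; move: deltaL delta_gt0 L_ge800 g_small; nra. Qed.
Let Lpow_ge1 n : 1 <= L ^ n.
Proof. by apply: pow_R1_Rle; move: L_ge800; lra. Qed.
Let r01 : 0 < r <= 1.
Proof.
have L7 := Lpow_ge1 7.
have h : r * (128 * L ^ 7) = 1 by rewrite /r Rinv_l //; lra.
split; first by apply: Rinv_0_lt_compat; lra.
by nra.
Qed.
Let Dmin_ge1 : 1 <= Dmin. Proof. by have := Lpow_ge1 14; rewrite /Dmin; lra. Qed.
Let r2Dmin : r ^ 2 * Dmin = 3.
Proof. by rewrite /r /Dmin; move: L_ge800 => h; field; lra. Qed.
Let gDmin : 1 <= g * Dmin.
Proof.
have -> : Dmin = 49152 * (L * L ^ 13) by rewrite /Dmin; ring.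
have := Lpow_ge1 13; have gL : 1 <= g * L by move: g_small L_large L_ge800; nra.
by move=> h; nra.
Qed.

(** The seventh power of [L] in [r] turns the exponent into [g ^ 4 * L ^ 5], which is at least
    [4 * L] as [g ^ 2 * L >= 8]. Since [D <= exp L], the left side is at most [2 * exp (- (2 * L))],
    which is below [delta]. *)
Lemma failure_prob_small D : 0 < D -> ln D <= L ->
  (1 + D ^ 2) * exp (- (delta ^ 2 / (8 * r))) <= delta.
Proof.
move=> D0 DL.
have -> : delta ^ 2 / (8 * r) = g ^ 4 * L ^ 5.
  by rewrite /delta /r; move: L_ge800 => h; field; lra.
have g4 : 4 * L <= g ^ 4 * L ^ 5.
  have -> : g ^ 4 * L ^ 5 = (g ^ 2 * L) ^ 2 * (L * L) * L by ring.
  have h64 : 64 <= (g ^ 2 * L) ^ 2 by nra.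
  have : 4 <= (g ^ 2 * L) ^ 2 * (L * L) by move: L_ge800; nra.
  by move: L_ge800; nra.
have De : D <= exp L by rewrite -(exp_ln D) //; apply: exp_monotone.
set E := exp (- L); have E0 : 0 < E by apply: exp_pos.
have EL : E * exp L = 1 by rewrite -exp_plus Rplus_opp_l exp_0.
have EL1 : E * L <= 1 by have := exp_ineq1_le L; nra.
have : exp (- (g ^ 4 * L ^ 5)) <= E ^ 4.
  have -> : E ^ 4 = exp (- (4 * L)).
    by rewrite /E /= Rmult_1_r -!exp_plus; congr exp; ring.
  by apply: exp_monotone; lra.
set X := exp _ => XE; have X0 : 0 < X by apply: exp_pos.
have E1 : E <= 1 by move: L_ge800; nra.
have ED : E * D <= 1 by nra.
have h1 : (1 + D ^ 2) * X <= (1 + D ^ 2) * E ^ 4 by apply: Rmult_le_compat_l => //; nra.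
have h2 : (1 + D ^ 2) * E ^ 4 = (E ^ 2 + (E * D) ^ 2) * E ^ 2 by ring.
have h3 : (E ^ 2 + (E * D) ^ 2) * E ^ 2 <= 2 * E ^ 2.
  by apply: Rmult_le_compat_r; [nra|]; have : 0 <= E * D; nra.
have h4 : 2 * E ^ 2 <= delta.
  apply: (Rmult_le_reg_r (L ^ 2)); first by have := Lpow_ge1 2; lra.
  have -> : 2 * E ^ 2 * L ^ 2 = 2 * (E * L) ^ 2 by ring.
  have -> : delta * L ^ 2 = g ^ 2 * L / 4.
    have -> : delta * L ^ 2 = delta * L * L by ring.
    by rewrite deltaL; field.
  by have : 0 <= E * L; move: L_ge800; nra.
by lra.
Qed.

Lemma density_recurrence D phi : Dmin <= D -> ln D <= L -> 0 <= phi ->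
  (1 - 6 * g) * (ln (Q * D) - ln Dmin) / (Q * D) <= phi ->
  (1 - 6 * g) * (ln D - ln Dmin) / D <=
  g / D * (1 - g) + phi * (1 - g - g ^ 2 - (1 + D ^ 2) * exp (- (delta ^ 2 / (8 * r)))).
Proof.
move=> DD DL phi0; have [Q2 Q1] := Q_bounds.
have D0 : 0 < D by move: Dmin_ge1; lra.
have := failure_prob_small D0 DL; set z := _ * exp _ => zd.
have lnQ : - (g + 4 * g ^ 2) <= ln Q.
  by apply: ln_ge_quadratic => //; rewrite /Q; move: delta_gt0; lra.
rewrite ln_mult //; last by lra.
set y := ln Q + ln D - ln Dmin => hphi.
have lnQ0 : ln Q <= 0 by rewrite -ln_1; apply: ln_monotone; lra.
have l0 : 0 <= ln Dmin by rewrite -ln_1; apply: ln_monotone => //; lra.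
have yL : y <= L by rewrite /y; lra.
set k := 1 - 6 * g in hphi *; have k01 : 0 < k <= 1 by rewrite /k; move: g_small; lra.
(* The 6 comes from here: [(1 - 6 * g) * (g + 5 * g ^ 2) = g - g ^ 2 - 30 * g ^ 3]. The extra
   [g ^ 2] pays for the error [delta + z]. *)
have gain : k * (- ln Q + g ^ 2) <= g * (1 - g).
  have : k * (- ln Q + g ^ 2) <= k * (g + 5 * g ^ 2) by apply: Rmult_le_compat_l; lra.
  by rewrite /k; move: g_small; nra.
apply: (Rmult_le_reg_r D) => //.
have -> : k * (ln D - ln Dmin) / D * D = k * (ln D - ln Dmin) by field; lra.
have -> : (g / D * (1 - g) + phi * (1 - g - g ^ 2 - z)) * D =
          g * (1 - g) + phi * D * (Q - (delta + z)) by rewrite /Q; field; lra.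
have hq : 0 <= Q - (delta + z) by move: deltaL delta_gt0 L_ge800 g_small; nra.
suff : k * y - k * g ^ 2 <= phi * D * (Q - (delta + z)).
  have : k * (ln D - ln Dmin) = k * y - k * ln Q by rewrite /y; ring.
  by lra.
have pD : k * y / Q <= phi * D.
  have -> : k * y / Q = k * y / (Q * D) * D by field; lra.
  by apply: Rmult_le_compat_r; lra.
case: (Rle_dec 0 y) => [y0|/Rnot_le_lt y0]; last first.
  apply: (Rle_trans _ 0); first by have := pow2_ge_0 g; nra.
  by apply: Rmult_le_pos => //; apply: Rmult_le_pos; lra.
apply: (Rle_trans _ (k * y / Q * (Q - (delta + z)))); last exact: Rmult_le_compat_r.
have -> : k * y / Q * (Q - (delta + z)) = k * y - k * (y * / Q * (delta + z)).
  by field; lra.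
suff : y * / Q * (delta + z) <= g ^ 2 by nra.
have Qi : 0 < / Q <= 2.
  split; first by apply: Rinv_0_lt_compat; lra.
  apply: (Rmult_le_reg_r Q); first lra.
  by rewrite Rinv_l; lra.
have a1 : y * / Q <= L * 2 by apply: Rmult_le_compat; lra.
have a0 : 0 <= y * / Q by apply: Rmult_le_pos; lra.
have : y * / Q * (delta + z) <= y * / Q * (2 * delta) by apply: Rmult_le_compat_l; lra.
have : y * / Q * (2 * delta) <= L * 2 * (2 * delta) by apply: Rmult_le_compat_r; move: delta_gt0; lra.
by move: deltaL; lra.
Qed.

(** Here [k] bounds the number of remaining rounds. Below [Dmin] the claimed size is at most 0 and
    the empty set suffices; above it, [r ^ 2 * D >= 3] and [g * D >= 1] hold and a round can be
    run. *)
Lemma density_iter k D (U : {set T}) : 0 < D -> ln D <= L -> D * Q ^ k < Dmin ->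
  sparse e r D U ->
  has_independent e U ((1 - 6 * g) * (ln D - ln Dmin) / D * INR #|U|).
Proof.
have small D' (V : {set T}) : 0 < D' -> ln D' - ln Dmin <= 0 ->
    has_independent e V ((1 - 6 * g) * (ln D' - ln Dmin) / D' * INR #|V|).
  move=> D0 lD; apply: has_independent_le0.
  have := pos_INR #|V|; have : 0 < / D' by apply: Rinv_0_lt_compat.
  have : 0 <= 1 - 6 * g by move: g_small; lra.
  rewrite /Rdiv => h1 h2 h3.
  have : (1 - 6 * g) * (ln D' - ln Dmin) <= 0 by nra.
  by move=> h4; have : (1 - 6 * g) * (ln D' - ln Dmin) * / D' <= 0; nra.
have [Q2 Q1] := Q_bounds.
elim: k D U => [|k IH] D U D0 DL Dk spU.
  by apply: small => //; have := @ln_monotone D Dmin D0; rewrite /= in Dk; lra.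
case: (Rlt_dec D Dmin) => [DD|/Rnot_lt_le DD].
  by apply: small => //; have := @ln_monotone D Dmin D0; lra.
pose phi0 := (1 - 6 * g) * (ln (Q * D) - ln Dmin) / (Q * D).
(* In the last round [Q * D] may fall below [Dmin] and make [phi0] negative, while [nibble_step]
   needs a nonnegative density; the maximum with 0 covers this case. *)
apply: has_independent_le (nibble_step e_sym e_irr (phi := Rmax 0 phi0)
  g_small delta_gt0 r01 _ _ spU _ _).
- apply: Rmult_le_compat_r; first exact: pos_INR.
  by apply: density_recurrence => //; [exact: Rmax_l | exact: Rmax_r].
- by rewrite -r2Dmin; apply: Rmult_le_compat_l => //; nra.
- by move: gDmin g_small; nra.
- exact: Rmax_l.
move=> U' spU'; rewrite /Rmax; case: Rle_dec => [_|_]; last first.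
  by apply: has_independent_le0; rewrite Rmult_0_l; apply: Rle_refl.
apply: IH => //.
- by nra.
- by rewrite ln_mult //; [have := @ln_monotone Q 1; rewrite ln_1; lra | lra].
- by move: Dk; rewrite /=; nra.
Qed.

Lemma sparse_has_independent D : 0 < D -> ln D = L ->
  sparse e r D [set: T] ->
  has_independent e [set: T] ((1 - 6 * g) * (L - ln Dmin) / D * INR #|T|).
Proof.
move=> D0 DL spT; have [Q2 Q1] := Q_bounds.
have [||k hk] := @pow_lt_1_zero Q _ (Dmin / D).
- by rewrite Rabs_pos_eq; lra.
- by apply: Rdiv_lt_0_compat => //; move: Dmin_ge1; lra.
rewrite -cardsT -DL; apply: (density_iter (k := k)) => //; first lra.
have := hk k (le_n k); rewrite Rabs_pos_eq; last by apply: pow_le; lra.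
move/(Rmult_lt_compat_l _ _ _ D0).
by have -> : D * (Dmin / D) = Dmin by field; lra.
Qed.

End Density.

(** * Choice of constants and conclusion *)

Lemma log_threshold_small eps L : 0 < eps -> (112 / eps) ^ 2 <= L ->
  196608 / eps <= L -> 1 <= L -> ln (49152 * L ^ 14) <= eps / 2 * L.
Proof.
move=> eps0 L1 L2 L3; pose s := sqrt L.
have sL : s * s = L by apply: sqrt_sqrt; lra.
have s0 : 0 < s by apply: sqrt_lt_R0; lra.
(* Half of the bound goes to each factor: [ln 49152 <= 49152 = 196608 / 4], and
   [14 * ln L <= 28 * sqrt L] with [28 = 112 / 4]. *)
rewrite ln_mult; [|lra|by apply: pow_lt; lra].
rewrite ln_pow; last lra.
have l1 : ln 49152 <= 49152 by apply: ln_le_self; lra.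
have l2 : ln L <= 2 * s by rewrite -sL ln_mult //; have := ln_le_self s0; lra.
have e1 : 112 / eps * eps = 112 by field; lra.
have e2 : 196608 / eps * eps = 196608 by field; lra.
have s1 : 112 / eps <= s.
  by apply: Rsqr_incr_0_var; [rewrite /Rsqr; lra | lra].
have e3 : 112 <= s * eps by rewrite -e1; apply: Rmult_le_compat_r; lra.
have e4 : 196608 <= L * eps by rewrite -e2; apply: Rmult_le_compat_r; lra.
have : 28 * s <= eps / 4 * L by rewrite -sL; nra.
by rewrite INR_IZR_INZ [Z.of_nat _]/=; lra.
Qed.

Lemma sparse_of_maxdeg (T : finType) (e : rel T) r D :
  INR (maxdeg e) <= D -> INR (maxcodeg e) <= r * D -> sparse e r D [set: T].
Proof.
move=> degD codD; split=> [v _|u v _ _ uv]; rewrite setIT.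
  by apply: Rle_trans degD; apply: INR_leq; exact: (@leq_bigmax _ (deg e)).
apply: Rle_trans codD; apply: INR_leq.
exact: (@leq_bigmax_cond _ (fun x => x.1 != x.2) (fun x => codeg e x.1 x.2) (u, v)).
Qed.

Theorem theorem1p3 :
  forall eps : R, Rlt 0 eps ->
  exists Delta0 : nat, forall Delta : nat, (Delta0 <= Delta)%N ->
  forall (T : finType) (e : rel T), simple_graph e ->
  (maxdeg e <= Delta)%N ->
  Rle (INR (maxcodeg e))
      (Rdiv (Rdiv (INR Delta) (pow 2 7)) (pow (ln (INR Delta)) 7)) ->
  Rle (Rmult (Rminus 1 eps) (Rdiv (Rmult (INR #|T|) (ln (INR Delta))) (INR Delta)))
      (INR (alpha e)).
Proof.
(* With [g <= eps / 12] the factor [1 - 6 * g] costs at most [eps / 2]; the other half is left for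
   [ln Dmin]. *)
move=> eps eps0; pose g := Rmin (1 / 10) (eps / 12).
have g0 : 0 < g <= 1 / 10.
  by split; [apply: Rmin_pos; lra | exact: Rmin_l].
have geps : g <= eps / 12 by exact: Rmin_r.
have a1 : 0 < 8 / g ^ 2 by apply: Rdiv_lt_0_compat; nra.
have a2 : 0 <= (112 / eps) ^ 2 by exact: pow2_ge_0.
have a3 : 0 < 196608 / eps by apply: Rdiv_lt_0_compat; lra.
pose L0 := 8 / g ^ 2 + (112 / eps) ^ 2 + 196608 / eps + 1.
have [Delta0 hD0] := INR_unbounded (exp L0).
exists Delta0 => Delta /INR_leq leD T e [e_sym e_irr] /INR_leq degD codD.
set D := INR Delta in leD degD codD *; set L := ln D in codD *.
have D0 : 0 < D by have := exp_pos L0; lra.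
have L0L : L0 <= L by rewrite -(ln_exp L0); apply: ln_monotone; [exact: exp_pos | lra].
rewrite /L0 in L0L.
have gL : 8 <= g ^ 2 * L.
  have -> : 8 = g ^ 2 * (8 / g ^ 2) by field; lra.
  by apply: Rmult_le_compat_l; [exact: pow2_ge_0 | lra].
have spT : sparse e (/ (128 * L ^ 7)) D [set: T].
  apply: sparse_of_maxdeg => //; apply: Rle_trans codD _; apply: Req_le.
  by rewrite -/L; field; lra.
have [I [_ Iind cI]] := sparse_has_independent e_sym e_irr g0 gL D0 erefl spT.
have cA : INR #|I| <= INR (alpha e).
  by apply: INR_leq; exact: (@leq_bigmax_cond _ (independent e) (fun S => #|S|)).
apply: Rle_trans cA; apply: Rle_trans cI.
have -> : (1 - eps) * (INR #|T| * L / D) = (1 - eps) * L / D * INR #|T| by field; lra.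
apply: Rmult_le_compat_r; first exact: pos_INR.
apply: Rmult_le_compat_r; first by apply/Rlt_le/Rinv_0_lt_compat.
have l1 : ln (49152 * L ^ 14) <= eps / 2 * L by apply: log_threshold_small => //; lra.
(* Nonnegativity lets the cross term [6 * g * ln Dmin] be dropped when the product
   [(1 - 6 * g) * (L - ln Dmin)] is expanded. *)
have l0 : 0 <= ln (49152 * L ^ 14).
  rewrite -ln_1; apply: ln_monotone; first lra.
  have : 1 <= L ^ 14 by apply: pow_R1_Rle; lra.
  by lra.
by nra.
Qed.
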